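(* Let $\mathbb{K}=\{x=(x_1,x_2,\dots)\in l_2:\ x_i\ge 0\text{ for all } i\in\mathbb{N}\}$ be the positive cone of the real Hilbert space $l_2$, let $P_{\mathbb{K}}:l_2\to\mathbb{K}$ be the metric projection onto $\mathbb{K}$, and let $\bar x\in l_2$. Then the regular coderivative of $P_{\mathbb{K}}$ at $\bar x$ is given by $$\widehat D^\ast P_{\mathbb{K}}(\bar x)(y)=\left\{z\in l_2:\ z_i=y_i \text{ for } i\in \bar x^+;\ z_i=0 \text{ for } i\in \bar x^-;\ 0\leq z_i\leq y_i \text{ for } i\in \bar x^\bullet\right\}\quad\text{for all } y\in l_2.$$
   Context: $l_2$ is the real Hilbert space of square-summable real sequences $x=(x_1,x_2,\dots)$ with its usual inner product $\langle\cdot,\cdot\rangle$ and norm $\|\cdot\|$. For $x\in l_2$, put $x^+=\{i\in\mathbb{N}: x_i>0\}$, $x^-=\{i\in\mathbb{N}: x_i<0\}$, $x^\bullet=\{i\in\mathbb{N}: x_i=0\}$. For a nonempty closed convex subset $C$ of a Hilbert space $H$, the metric projection $P_C:H\to C$ sends $x$ to the unique $y\in C$ with $\|x-y\|=\inf_{z\in C}\|x-z\|$. For a nonempty subset $\Omega$ of a Hilbert space $H$ and $\bar x\in\Omega$, the Fréchet (regular) normal cone is $$\widehat N_\Omega(\bar x)=\Big\{z\in H:\ \limsup_{u\to\bar x,\ u\in\Omega}\frac{\langle z,u-\bar x\rangle}{\|u-\bar x\|}\le 0\Big\}$$ and $\widehat N_\Omega(\bar x)=\emptyset$ if $\bar x\notin\Omega$.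 The product $H\times H$ carries the inner product $\langle (x,y),(u,v)\rangle=\langle x,u\rangle+\langle y,v\rangle$. For a single-valued map $\Phi:H\to H$ with graph $\mathrm{gph}\,\Phi=\{(x,\Phi(x)):x\in H\}$, the regular coderivative of $\Phi$ at $\bar x$ is the set-valued map $$\widehat D^\ast\Phi(\bar x)(y)=\{z\in H:\ (z,-y)\in\widehat N_{\mathrm{gph}\,\Phi}(\bar x,\Phi(\bar x))\},\quad y\in H.$$ *)

(* Defs.v *)
From HB Require Import structures.
From mathcomp Require Import all_boot all_order all_algebra.
From mathcomp Require Import sesquilinear ring lra.
From mathcomp Require Import all_classical all_reals all_analysis.

Set Implicit Arguments.
Unset Strict Implicit.
Unset Printing Implicit Defensive.

Import Order.TTheory GRing.Theory Num.Theory.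
Import numFieldNormedType.Exports.

Local Open Scope classical_set_scope.
Local Open Scope ring_scope.

(* Real Hilbert spaces: complete normed modules whose norm comes from a
   (symmetric, bilinear, positive definite) inner product. *)
HB.mixin Record NormedModule_hasInner (R : realType) V & NormedModule R V := {
  inner : {dot V for @idfun R};
  inner_norm : forall x : V, inner x x = `|x| ^+ 2
}.

#[short(type="hilbertType")]
HB.structure Definition Hilbert (R : realType) :=
  {V of CompleteNormedModule R V & NormedModule_hasInner R V}.

Section dot_norm.
Context (R : realType) (U : lmodType R) (d : {dot U for @idfun R}).

Definition dot_norm (x : U) : R := Num.sqrt (d x x).

Lemma dotC x y : d x y = d y x.
Proof. by rewrite (hermC d) expr0 mul1r. Qed.

Lemma dot_ge0 x : 0 <= d x x.
Proof.
by have [->|/(neq0_dnorm_gt0 (s := d))/ltW//] := eqVneq x 0; rewrite linear0l.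
Qed.

Lemma dot_normE x : dot_norm x ^+ 2 = d x x.
Proof. by rewrite sqr_sqrtr// dot_ge0. Qed.

Lemma dot_norm0_eq0 x : dot_norm x = 0 -> x = 0.
Proof.
move=> /(congr1 (fun r => r ^+ 2)); rewrite dot_normE expr0n/= => dx.
apply/eqP; apply: contraPT dx => /(neq0_dnorm_gt0 (s := d)) /lt0r_neq0/eqP//.
Qed.

Lemma dot_normZ (l : R) x : dot_norm (l *: x) = `|l| * dot_norm x.
Proof.
rewrite /dot_norm linearZl_LR linearZr_LR/= mulrA -expr2.
by rewrite sqrtrM ?sqr_ge0// sqrtr_sqr.
Qed.

Lemma ler_dot_normM x y : d x y <= dot_norm x * dot_norm y.
Proof.
have [->|x0] := eqVneq x 0; first by rewrite linear0l mulr_ge0// sqrtr_ge0.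
have [->|y0] := eqVneq y 0; first by rewrite linear0r mulr_ge0// sqrtr_ge0.
have nx : 0 < dot_norm x by rewrite sqrtr_gt0 (neq0_dnorm_gt0 (s := d)).
have ny : 0 < dot_norm y by rewrite sqrtr_gt0 (neq0_dnorm_gt0 (s := d)).
have := dot_ge0 (dot_norm y *: x - dot_norm x *: y).
rewrite (hnormB d)/= !expr0 mul1r !linearZl_LR !linearZr_LR/= -!dot_normE.
set a := dot_norm x; set b := dot_norm y; set c := d x y => h.
have ab : 0 < a * b by rewrite mulr_gt0.
rewrite -(ler_pM2l ab) -subr_ge0 -(pmulr_rge0 _ (ltr0Sn R 1)).
by apply: le_trans h _; rewrite /GRing.scale/= le_eqVlt; apply/orP; left; apply/eqP; ring.
Qed.

Lemma ler_dot_normD x y : dot_norm (x + y) <= dot_norm x + dot_norm y.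
Proof.
rewrite -(@ler_pXn2r _ 2)// ?nnegrE ?addr_ge0 ?sqrtr_ge0//.
rewrite dot_normE (hnormD d)/= expr0 mul1r sqrrD !dot_normE addrAC lerD2r lerD2l.
by rewrite mulr2n lerD// ler_dot_normM.
Qed.

End dot_norm.

Section square_summable.
Context (R : realType).
Implicit Types x y : nat -> R.

Definition square_summable : {pred nat -> R} :=
  [pred x : nat -> R | `[< cvgn (series (fun i => x i ^+ 2)) >]].

Lemma cvg_seriesM x y : x \in square_summable -> y \in square_summable ->
  cvgn (series (fun i => x i * y i)).
Proof.
move=> /asboolP xs /asboolP ys; apply: normed_cvg.
apply: series_le_cvg (is_cvg_seriesD xs ys) => /= n; rewrite ?normr_ge0//.
  by rewrite addr_ge0// sqr_ge0.
rewrite normrM !fctE -(real_normK (num_real (x n))).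
by rewrite -(real_normK (num_real (y n))); nra.
Qed.

Lemma square_summable_submod_closed : submod_closed square_summable.
Proof.
split=> [|a x y xs ys]; apply/asboolP.
  rewrite (_ : series _ = cst 0); first exact: is_cvg_cst.
  by apply/funext => n; rewrite /series/= big1// => i _; rewrite expr0n.
have /asboolP xs' := xs; have /asboolP ys' := ys.
rewrite (_ : (fun _ => _) = (a ^+ 2 *: (fun i => x i ^+ 2))
  + ((2 * a) *: (fun i => x i * y i)) + (fun i => y i ^+ 2)).
  apply: is_cvg_seriesD => //; apply: is_cvg_seriesD.
    exact: is_cvg_seriesZ.
  exact/is_cvg_seriesZ/cvg_seriesM.
by apply/funext => i /=; rewrite !fctE /= /GRing.scale/=; ring.
Qed.

HB.instance Definition _ := GRing.isSubmodClosed.Build R (nat -> R)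
  square_summable square_summable_submod_closed.

End square_summable.

(* Sequences are indexed from 0 instead of 1. *)
Record l2 (R : realType) := L2 {
  l2_seq :> nat -> R;
  _ : l2_seq \in @square_summable R
}.
Arguments L2 {R} l2_seq _.

HB.instance Definition _ (R : realType) := [isSub for @l2_seq R].
HB.instance Definition _ (R : realType) := [Choice of l2 R by <:].
HB.instance Definition _ (R : realType) :=
  [SubChoice_isSubLmodule of l2 R by <:].

Section l2_inner.
Context (R : realType).
Implicit Types (x y z : l2 R) (a : R).

Definition l2_inner x y : R := limn (series (fun i => x i * y i)).

Lemma l2P x : l2_seq x \in @square_summable R.
Proof. exact: valP. Qed.

Lemma l2D x y i : (x + y) i = x i + y i. Proof. by []. Qed.

Lemma l2N x i : (- x) i = - x i. Proof. by []. Qed.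

Lemma l2Z a x i : (a *: x) i = a * x i. Proof. by []. Qed.

Lemma l2_cvgM x y : cvgn (series (fun i => x i * y i)).
Proof. by apply: cvg_seriesM; exact: l2P. Qed.

Lemma l2_cvg_sqr x : cvgn (series (fun i => x i ^+ 2)).
Proof. exact/asboolP/(l2P x). Qed.

Lemma l2_innerC x y : l2_inner x y = l2_inner y x.
Proof.
by rewrite /l2_inner; under eq_fun do rewrite mulrC.
Qed.

Lemma l2_inner_linearl y : linear_for *%R (l2_inner ^~ y).
Proof.
move=> a x z; rewrite /l2_inner -[a * _]/(a *: _) -lim_seriesZ; last exact: l2_cvgM.
rewrite -lim_seriesD; [|exact/is_cvg_seriesZ/l2_cvgM|exact: l2_cvgM].
by congr (limn (series _)); apply/funext => i; rewrite l2D l2Z mulrDl -mulrA.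
Qed.

Lemma l2_inner_bilinear : bilinear_for *%R *%R l2_inner.
Proof.
split=> [y|x]; first exact: l2_inner_linearl.
by move=> a y z; rewrite l2_innerC l2_inner_linearl !(l2_innerC x).
Qed.

HB.instance Definition _ :=
  bilinear_isBilinear.Build R (l2 R) (l2 R) R *%R *%R l2_inner l2_inner_bilinear.

Lemma l2_inner_herm x y : l2_inner x y = (-1) ^+ false * idfun (l2_inner y x).
Proof. by rewrite expr0 mul1r/= l2_innerC. Qed.

HB.instance Definition _ :=
  isHermitianSesquilinear.Build R (l2 R) false idfun l2_inner l2_inner_herm.

Lemma l2_series_le x n : series (fun i => x i ^+ 2) n <= l2_inner x x.
Proof.
apply: nondecreasing_cvgn_le; last exact: l2_cvg_sqr.
by apply: nondecreasing_series => i _ _; rewrite sqr_ge0.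
Qed.

Lemma l2_inner_gt0 x : x != 0 -> 0 < l2_inner x x.
Proof.
move=> x0; have [i xi] : exists i, x i != 0.
  apply: contrapT => /forallNP x_eq0; move/eqP: x0; apply.
  by apply/val_inj/funext => i; apply/eqP/negPn/negP/x_eq0.
apply: lt_le_trans (l2_series_le x i.+1).
rewrite seriesEnat/= big_nat_recr//= ltr_wpDl ?exprn_even_gt0//.
by apply: sumr_ge0 => j _; rewrite sqr_ge0.
Qed.

HB.instance Definition _ := isDotProduct.Build R (l2 R) l2_inner l2_inner_gt0.

End l2_inner.

Section l2_hilbert.
Context (R : realType).

Definition l2_dot : {dot l2 R for @idfun R} := @l2_inner R.

HB.instance Definition _ := Lmodule_isNormed.Build R (l2 R)
  (ler_dot_normD l2_dot) (dot_normZ l2_dot) (@dot_norm0_eq0 _ _ l2_dot).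

Lemma l2_inner_norm (x : l2 R) : l2_dot x x = `|x| ^+ 2.
Proof. exact/esym/(dot_normE l2_dot). Qed.

Lemma l2_sum_le (x : l2 R) n : \sum_(0 <= i < n) x i ^+ 2 <= `|x| ^+ 2.
Proof. by rewrite -l2_inner_norm; exact: l2_series_le. Qed.

Lemma l2_coord_le (x : l2 R) i : `|x i| <= `|x|.
Proof.
rewrite -(@ler_pXn2r _ 2)// ?nnegrE// real_normK ?num_real//.
apply: le_trans (l2_sum_le x i.+1).
by rewrite big_nat_recr//= lerDr sumr_ge0// => j _; rewrite sqr_ge0.
Qed.

Lemma l2_norm_le (x : l2 R) (e : R) : 0 <= e ->
  (forall n, \sum_(0 <= i < n) x i ^+ 2 <= e ^+ 2) -> `|x| <= e.
Proof.
move=> e0 xe; rewrite -(@ler_pXn2r _ 2)// ?nnegrE// -l2_inner_norm.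
apply: limr_le; first exact: l2_cvgM.
by apply: nearW => n; rewrite seriesEnat/=.
Qed.

Lemma l2_complete (F : set_system (l2 R)) : ProperFilter F -> cauchy F -> cvg F.
Proof.
move=> FF /cauchyP Fc.
have coord_cvg i : cvg ((fun u : l2 R => u i) @ F).
  apply/cauchy_cvgP/cauchyP => e /Fc[x xe]; exists (x i).
  rewrite /fmap/=; apply: filterS xe => u.
  rewrite -!ball_normE /ball_/=; apply: le_lt_trans.
  exact: (l2_coord_le (x - u) i).
pose l i : R := lim ((fun u : l2 R => u i) @ F).
have tail e : 0 < e ->
    \forall u \near F, forall n, \sum_(0 <= i < n) (l i - (u : l2 R) i) ^+ 2 <= e ^+ 2.
  move=> e0; have [x xe] := Fc _ (divr_gt0 e0 (ltr0Sn R 1)).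
  near=> u => n.
  have cv : (fun v : l2 R => \sum_(0 <= i < n) (v i - u i) ^+ 2) @ F -->
      \sum_(0 <= i < n) (l i - u i) ^+ 2.
    elim: n => [|n IHn].
      by rewrite big_geq//; under eq_fun do rewrite big_geq//; exact: cvg_cst.
    rewrite big_nat_recr//=; under eq_fun do rewrite big_nat_recr//=.
    apply: cvgD => //; rewrite expr2; under eq_fun do rewrite expr2.
    have cn : (fun v : l2 R => v n - u n) @ F --> l n - u n.
      by apply: cvgB; [exact: coord_cvg|exact: cvg_cst].
    exact: (cvgM cn cn).
  rewrite -(cvg_lim _ cv)//; apply: limr_le; first exact: cvgP cv.
  near=> v; apply: le_trans (l2_sum_le (v - u) n) _.
  rewrite ler_pXn2r ?nnegrE ?(ltW e0)//.
  apply/ltW/(@le_lt_trans _ _ (`|x - v| + `|x - u|)).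
    have -> : v - u = (x - u) - (x - v).
      by rewrite opprB [RHS]addrC addrA subrK.
    by rewrite [leRHS]addrC; exact: ler_normB.
  rewrite (splitr e) ltrD//.
    by near: v; move: (xe); rewrite -ball_normE; exact.
  by near: u; move: (xe); rewrite -ball_normE; exact.
have [u0 u0l] : exists u0 : l2 R,
    forall n, \sum_(0 <= i < n) (l i - u0 i) ^+ 2 <= 1 ^+ 2.
  exact: filter_ex (tail 1 ltr01).
have d_sum : (fun i => l i - u0 i) \in @square_summable R.
  apply/asboolP/nondecreasing_is_cvgn.
    by apply: nondecreasing_series => i _ _; rewrite sqr_ge0.
  by exists (1 ^+ 2) => _ [n _ <-]; rewrite seriesEnat/=.
pose L := (L2 _ d_sum : l2 R) + u0.
have LE i : L i = l i by rewrite l2D/= subrK.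
apply/cvg_ex; exists L; apply/cvgrPdist_le => /= e e0.
near=> u; apply: l2_norm_le; first exact: ltW.
move=> n; under eq_bigr do rewrite l2D l2N LE.
by move: n; near: u; exact: tail.
Unshelve. all: by end_near. Qed.

HB.instance Definition _ := Uniform_isComplete.Build (l2 R) l2_complete.
HB.instance Definition _ :=
  NormedModule_hasInner.Build R (l2 R) l2_inner_norm.

End l2_hilbert.


Section hilbert_product.
Context (R : realType) (H1 H2 : hilbertType R).

(* MathComp-Analysis puts the max norm on H1 * H2; this alias carries the
   Hilbert norm `|(x, y)|^2 = `|x|^2 + `|y|^2 instead. *)
Definition hprod : Type := (H1 * H2)%type.

HB.instance Definition _ := GRing.Lmodule.on hprod.

Definition hprod_inner (p q : hprod) : R :=
  inner p.1 q.1 + inner p.2 q.2.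

Lemma hprod_inner_bilinear : bilinear_for *%R *%R hprod_inner.
Proof.
split=> [q|q] a p p'; rewrite /hprod_inner/=.
  rewrite !linearDl/= !linearZl_LR/= addrACA; congr (_ + _).
  exact/esym/mulrDr.
by rewrite !linearDr/= !linearZr_LR/= addrACA; congr (_ + _).
Qed.

HB.instance Definition _ := bilinear_isBilinear.Build R hprod hprod R *%R *%R
  hprod_inner hprod_inner_bilinear.

Lemma hprod_inner_herm p q :
  hprod_inner p q = (-1) ^+ false * idfun (hprod_inner q p).
Proof. by rewrite expr0 mul1r /hprod_inner/= dotC (dotC _ p.2). Qed.

HB.instance Definition _ := isHermitianSesquilinear.Build R hprod false idfun
  hprod_inner hprod_inner_herm.

Lemma hprod_inner_gt0 p : p != 0 -> 0 < hprod_inner p p.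
Proof.
rewrite lt0r addr_ge0 ?dot_ge0// andbT; apply: contra.
rewrite paddr_eq0 ?dot_ge0// !inner_norm !expf_eq0/= !normr_eq0.
by case: p => a b /= /andP[/eqP-> /eqP->].
Qed.

HB.instance Definition _ :=
  isDotProduct.Build R hprod hprod_inner hprod_inner_gt0.

Definition hprod_dot : {dot hprod for @idfun R} := hprod_inner.

HB.instance Definition _ := Lmodule_isNormed.Build R hprod
  (ler_dot_normD hprod_dot) (dot_normZ hprod_dot) (@dot_norm0_eq0 _ _ hprod_dot).

Lemma hprod_inner_norm (p : hprod) : hprod_dot p p = `|p| ^+ 2.
Proof. exact/esym/(dot_normE hprod_dot). Qed.

Lemma hprod_norm_fst (p : hprod) : `|p.1| <= `|p|.
Proof.
rewrite -(@ler_pXn2r _ 2)// ?nnegrE// -hprod_inner_norm -inner_norm.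
by rewrite lerDl dot_ge0.
Qed.

Lemma hprod_norm_snd (p : hprod) : `|p.2| <= `|p|.
Proof.
rewrite -(@ler_pXn2r _ 2)// ?nnegrE// -hprod_inner_norm -inner_norm.
by rewrite lerDr dot_ge0.
Qed.

Lemma hprod_norm_le (p : hprod) : `|p| <= `|p.1| + `|p.2|.
Proof.
rewrite -(@ler_pXn2r _ 2)// ?nnegrE ?addr_ge0// -hprod_inner_norm.
rewrite /hprod_dot/= /hprod_inner !inner_norm sqrrD addrAC lerDl.
by rewrite mulrn_wge0// mulr_ge0.
Qed.

Lemma hprod_complete (F : set_system hprod) :
  ProperFilter F -> cauchy F -> cvg F.
Proof.
move=> FF /cauchyP Fc.
have c1 : cvg ((fun p : hprod => p.1) @ F).
  apply/cauchy_cvgP/cauchyP => e /Fc[x xe]; exists x.1.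
  rewrite /fmap/=; apply: filterS xe => u.
  rewrite -!ball_normE /ball_/=; apply: le_lt_trans.
  exact: (hprod_norm_fst (x - u)).
have c2 : cvg ((fun p : hprod => p.2) @ F).
  apply/cauchy_cvgP/cauchyP => e /Fc[x xe]; exists x.2.
  rewrite /fmap/=; apply: filterS xe => u.
  rewrite -!ball_normE /ball_/=; apply: le_lt_trans.
  exact: (hprod_norm_snd (x - u)).
apply/cvg_ex; exists (lim ((fun p : hprod => p.1) @ F),
                      lim ((fun p : hprod => p.2) @ F)).
apply/cvgrPdist_le => /= e e0; near=> u.
apply: le_trans (hprod_norm_le _) _; rewrite /= (splitr e) lerD//.
  by near: u; move/cvgrPdist_le: c1; apply; rewrite divr_gt0.
by near: u; move/cvgrPdist_le: c2; apply; rewrite divr_gt0.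
Unshelve. all: by end_near. Qed.

HB.instance Definition _ := Uniform_isComplete.Build hprod hprod_complete.
HB.instance Definition _ := NormedModule_hasInner.Build R hprod hprod_inner_norm.

End hilbert_product.

Section variational.
Context (R : realType) (H : hilbertType R).

(* When C is nonempty, closed and convex there is exactly one such y; the
   default value 0 is returned only if there is none. *)
Definition metric_projection (C : set H) (x : H) : H :=
  xget 0 [set y | C y /\ `|x - y| = inf [set `|x - z| | z in C]].

(* Empty when x is not in Omega. The filter [within Omega x^'] is that of
   u --> x with u in Omega and u <> x, the point u = x being the one where the
   quotient is not defined; at an isolated point of Omega the limsup is -oo. *)
Definition regular_normal_cone (Omega : set H) (x : H) : set H :=
  [set z | Omega x /\
    (limf_esup (fun u => (inner z (u - x) / `|u - x|)%:E)
       (within Omega x^') <= 0)%E].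

End variational.

Definition graph_set (R : realType) (H : hilbertType R) (Phi : H -> H) :
  set (hprod H H) := [set p | p.2 = Phi p.1].

Definition regular_coderivative (R : realType) (H : hilbertType R)
    (Phi : H -> H) (x y : H) : set H :=
  [set z | regular_normal_cone (graph_set Phi) (x, Phi x) (z, - y)].

Definition positive_cone (R : realType) : set (l2 R) :=
  [set x | forall i, 0 <= x i].
Arguments positive_cone R : clear implicits.

Definition pos_index (R : realType) (x : l2 R) : set nat := [set i | 0 < x i].
Definition neg_index (R : realType) (x : l2 R) : set nat := [set i | x i < 0].
Definition zero_index (R : realType) (x : l2 R) : set nat := [set i | x i = 0].

(* Main.v *)
Require Import Defs.
From mathcomp Require Import all_boot all_order all_algebra.
From mathcomp Require Import lra.
From mathcomp Require Import all_classical all_reals all_analysis.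

Set Implicit Arguments.
Unset Strict Implicit.
Unset Printing Implicit Defensive.

Import Order.TTheory GRing.Theory Num.Theory.
Import numFieldNormedType.Exports.

Local Open Scope classical_set_scope.
Local Open Scope ring_scope.

(** Why the theorem holds.  The projection onto the positive cone takes the
    positive part of every coordinate ([metric_projection_positive_cone]), so it
    is 1-Lipschitz, and the norm of an increment of its graph is comparable to
    the norm of the increment [h] of the argument.  Hence [z] belongs to the
    coderivative at [y] exactly when
<<
      <z, h> - <y, P (x + h) - P x> <= e |h|    for h near 0, for every e > 0
>>
    ([regular_coderivative_nonexpansiveP]).  The left-hand side is the sum over
    [i] of the one-dimensional residuals
    [z_i h_i - y_i (max (x_i + h_i) 0 - max x_i 0)].

    Necessity is a one-dimensional fact: for [h] a multiple of a basis vector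
    only one residual survives, and comparing the slopes of [s |-> max (x_i + s) 0]
    on the two sides of [0] gives the three conditions ([residual_littleo]).

    For sufficiency, the conditions make the [i]-th residual nonpositive unless
    [0 < |x_i| <= |h_i|], that is, unless [x_i] is nonzero and [h_i] is large
    enough to bring it to [0]; in every case the residual is at most
    [|y_i| |h_i|].  When infinitely many [x_i] are nonzero they tend to [0], so no
    neighbourhood of [0] excludes these exceptional indices altogether, and [P]
    need not be differentiable at [x] even if all its coordinates are nonzero.
    But for any [N], a small enough [h] has no exceptional index below [N] ([l2_gap]), so Cauchy-Schwarz
    bounds the sum by [|h|] times the norm of the tail of [y] from [N] on, which
    is at most [e] for a suitable [N] ([l2_tail_small]). *)

(** * Regular normals and coderivatives without limits superior *)

(** The inequality on the right holds trivially at [u = x], which is why the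
    deleted neighbourhood can be replaced by a full one. *)
Lemma regular_normal_coneP (R : realType) (H : hilbertType R) (Omega : set H)
    (x z : H) :
  regular_normal_cone Omega x z <->
  Omega x /\ forall e : R, 0 < e ->
    \forall u \near x, Omega u -> inner z (u - x) <= e * `|u - x|.
Proof.
split=> -[Ox Hz]; split => //.
  move=> e e0.
  have /ereal_inf_lt[_ [V VF <-]] : (limf_esup
      (fun u => (inner z (u - x) / `|u - x|)%:E) (within Omega x^') < e%:E)%E.
    by apply: le_lt_trans Hz _; rewrite lte_fin.
  move=> supV.
  have {}VF : \forall u \near x, u != x -> Omega u -> V u by [].
  apply: filterS VF => u uV Ou.
  have [->|ux] := eqVneq u x; first by rewrite subrr normr0 mulr0 linear0r.
  have u0 : 0 < `|u - x| by rewrite normr_gt0 subr_eq0.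
  rewrite -ler_pdivrMr// -lee_fin; apply: le_trans (ltW supV).
  by apply: ereal_sup_ubound; exists u => //; exact: uV.
apply/lee_addgt0Pr => e e0; rewrite add0e.
apply: (@le_trans _ _ (ereal_sup ((fun u => (inner z (u - x) / `|u - x|)%:E) @`
   [set u | u != x /\ inner z (u - x) <= e * `|u - x|]))).
  apply: ereal_inf_lbound; eexists; last reflexivity.
  have := Hz _ e0; rewrite /within /= => Hn.
  suff : \forall u \near x, u != x -> Omega u ->
    u != x /\ inner z (u - x) <= e * `|u - x| by [].
  by apply: filterS Hn => u uV ux Ou; split => //; exact: uV.
apply: ge_ereal_sup => _ [u [ux uV] <-].
by rewrite lee_fin ler_pdivrMr// normr_gt0 subr_eq0.
Qed.

(** The Lipschitz bound gives [|h| <= |(h, k)| <= 2 |h|] for the increment [k] of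
    [Phi] along [h], so the smallness condition can be measured by the argument
    alone and the product norm disappears. *)
Lemma regular_coderivative_nonexpansiveP (R : realType) (H : hilbertType R)
    (Phi : H -> H) (x y z : H) :
  (forall u v, `|Phi u - Phi v| <= `|u - v|) ->
  regular_coderivative Phi x y z <->
  forall e : R, 0 < e -> \forall h \near (0 : H),
    inner z h - inner y (Phi (x + h) - Phi x) <= e * `|h|.
Proof.
move=> Phi1; rewrite /regular_coderivative /=.
have innerE (p : hprod H H) :
    inner ((z, - y) : hprod H H) p = inner z p.1 - inner y p.2.
  by rewrite [LHS]/(inner z p.1 + inner (- y) p.2) linearNl.
split=> [/regular_normal_coneP[_ Hz] e e0|Hz].
  have /nbhs_normP[d /= d0 Hd] := Hz _ (divr_gt0 e0 (ltr0Sn R 1)).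
  apply/nbhs_normP; exists (d / 2); rewrite /= ?divr_gt0//.
  move=> h; rewrite /ball_/= sub0r normrN => hd.
  pose p : hprod H H := (x + h, Phi (x + h)).
  have pE : p - (x, Phi x) = (h, Phi (x + h) - Phi x).
    by rewrite /p; congr (_, _); rewrite /= addrC addKr.
  have np : `|p - (x, Phi x)| <= 2 * `|h|.
    apply: le_trans (hprod_norm_le _) _; rewrite pE/= mulr2n mulrDl !mul1r lerD2l.
    by apply: le_trans (Phi1 _ _) _; rewrite addrC addKr.
  have := Hd p; rewrite /= innerE pE/= -pE => H1.
  apply: le_trans (H1 _ _) _ => //.
    rewrite /ball_/= distrC; apply: le_lt_trans np _.
    by rewrite mulrC -ltr_pdivlMr.
  by rewrite mulrAC ler_pdivrMr// -mulrA ler_pM2l// mulrC.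
apply/regular_normal_coneP; split=> // e e0.
have /nbhs_normP[d /= d0 Hd] := Hz _ e0.
apply/nbhs_normP; exists d => //= p; rewrite /ball_/= distrC => pd pP.
have n1 := hprod_norm_fst (p - (x, Phi x)).
rewrite innerE; apply: (@le_trans _ _ (e * `|(p - (x, Phi x)).1|)); last first.
  by rewrite ler_pM2l.
have := Hd (p.1 - x); rewrite /= (addrC x) subrK.
rewrite -pP; apply; rewrite /ball_/= sub0r normrN.
exact: le_lt_trans pd.
Qed.

(** * Coordinatewise comparison in l2 *)

(** Reduces an inequality between inner products or squared norms to one between
    real numbers in each coordinate; differences are covered by negating [c]. *)
Lemma ler_l2_innerD (R : realType) (a b c d p q : l2 R) :
  (forall i, a i * b i + c i * d i <= p i * q i) ->
  inner a b + inner c d <= inner p q.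
Proof.
move=> abcd.
have -> : inner a b + inner c d =
    limn (series ((fun i => a i * b i) + (fun i => c i * d i))).
  by rewrite lim_seriesD//; exact: l2_cvgM.
apply: ler_lim; [by apply: is_cvg_seriesD; exact: l2_cvgM|exact: l2_cvgM|].
by apply: nearW => n; rewrite !seriesEnat/=; apply: ler_sum => i _; exact: abcd.
Qed.

Lemma l2_norm_sqrD_le (R : realType) (a b c : l2 R) :
  (forall i, a i ^+ 2 + b i ^+ 2 <= c i ^+ 2) ->
  `|a| ^+ 2 + `|b| ^+ 2 <= `|c| ^+ 2.
Proof. by move=> abc; rewrite -!inner_norm; exact: ler_l2_innerD. Qed.

Lemma ler_l2_norm (R : realType) (a b : l2 R) :
  (forall i, `|a i| <= `|b i|) -> `|a| <= `|b|.
Proof.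
move=> ab; rewrite -(@ler_pXn2r _ 2)// ?nnegrE//.
apply: (@le_trans _ _ (`|a| ^+ 2 + `|0 : l2 R| ^+ 2)).
  by rewrite normr0 expr0n addr0.
apply: l2_norm_sqrD_le => i; rewrite expr0n/= addr0.
by rewrite -ler_sqrt ?sqr_ge0// !sqrtr_sqr.
Qed.

Lemma square_summable_dominated (R : realType) (x : l2 R) (f : nat -> R) :
  (forall i, `|f i| <= `|x i|) -> f \in @square_summable R.
Proof.
move=> fx; apply/asboolP.
apply: (@series_le_cvg _ _ (fun i => x i ^+ 2)) => [i|i|i|] /=.
- exact: sqr_ge0.
- exact: sqr_ge0.
- by rewrite -ler_sqrt ?sqr_ge0// !sqrtr_sqr.
- exact: l2_cvg_sqr.
Qed.

Definition l2_dominated (R : realType) (x : l2 R) (f : nat -> R)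
  (fx : forall i, `|f i| <= `|x i|) : l2 R := L2 f (square_summable_dominated fx).

(** * Projection onto the positive cone *)

Lemma normr_max0_le (R : realDomainType) (a : R) : `|Num.max a 0| <= `|a|.
Proof. by case: (lerP a 0) => //; rewrite normr0. Qed.

Definition l2_pos (R : realType) (x : l2 R) : l2 R :=
  l2_dominated (fun i => normr_max0_le (x i)).

Lemma l2_posE (R : realType) (x : l2 R) i : l2_pos x i = Num.max (x i) 0.
Proof. by []. Qed.

Lemma normr_max0B (R : realDomainType) (a b : R) :
  `|Num.max a 0 - Num.max b 0| <= `|a - b|.
Proof.
case: (lerP a 0) => a0; case: (lerP b 0) => b0 //; first by rewrite subrr normr0.
  by rewrite sub0r normrN gtr0_norm// ler0_norm; lra.
by rewrite subr0 gtr0_norm// ger0_norm; lra.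
Qed.

Lemma l2_pos_nonexpansive (R : realType) (u v : l2 R) :
  `|l2_pos u - l2_pos v| <= `|u - v|.
Proof. by apply: ler_l2_norm => i; exact: normr_max0B. Qed.

(** For a single real number [r] and [0 <= z], the residue [r - max r 0] has a
    nonpositive product with [z - max r 0].  Summed over the coordinates, this
    makes [l2_pos x] at once a nearest point of the cone and the only one. *)
Lemma l2_pos_pythagoras (R : realType) (x z : l2 R) : positive_cone R z ->
  `|x - l2_pos x| ^+ 2 + `|l2_pos x - z| ^+ 2 <= `|x - z| ^+ 2.
Proof.
move=> Kz; apply: l2_norm_sqrD_le => i; rewrite !l2D !l2N l2_posE.
have := Kz i; case: (lerP (x i) 0) => xi zi; nra.
Qed.

Lemma metric_projection_positive_cone (R : realType) :
  metric_projection (positive_cone R) = @l2_pos R.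
Proof.
apply/funext => x; rewrite /metric_projection.
have Kx : positive_cone R (l2_pos x) by move=> i; rewrite l2_posE le_max lexx orbT.
have infE : inf [set `|x - z| | z in positive_cone R] = `|x - l2_pos x|.
  apply/eqP; rewrite eq_le; apply/andP; split.
    apply: inf_lbound; last by exists (l2_pos x).
    by exists 0 => _ [z _ <-].
  apply: lb_le_inf; first by exists `|x - l2_pos x|, (l2_pos x).
  move=> _ [z Kz <-]; rewrite -(@ler_pXn2r _ 2)// ?nnegrE//.
  by apply: le_trans (l2_pos_pythagoras x Kz); rewrite lerDl sqr_ge0.
case: xgetP => [y _ [Ky]|/(_ (l2_pos x))]; last by case.
rewrite infE => yE; have := l2_pos_pythagoras x Ky.
rewrite yE gerDl => h; apply/esym/eqP; rewrite -subr_eq0 -normr_eq0.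
by rewrite -sqrf_eq0 eq_le h sqr_ge0.
Qed.

(** * Tails, gaps and basis directions *)

(** The tail is returned as a vector of l2, with absolute values taken, so that
    it can be used directly in the Cauchy-Schwarz inequality. *)
Lemma l2_tail_small (R : realType) (y : l2 R) (e : R) : 0 < e ->
  exists (N : nat) (t : l2 R), [/\ `|t| <= e, forall i, 0 <= t i &
    forall i, (N <= i)%N -> t i = `|y i|].
Proof.
move=> e0.
have headP N i : `|if (i < N)%N then y i else 0| <= `|y i|.
  by case: ifP => //; rewrite normr0.
have tailP N i : `|if (i < N)%N then 0 else `|y i| | <= `|y i|.
  by case: ifP => //; rewrite ?normr0// normr_id.
have [N SN] : exists N, `|y| ^+ 2 - e ^+ 2 < series (fun i => y i ^+ 2) N.
  have ylt : `|y| ^+ 2 - e ^+ 2 < limn (series (fun i => y i ^+ 2)).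
    by rewrite -inner_norm gtrDl oppr_lt0 exprn_gt0.
  have cvy : series (fun i => y i ^+ 2) @ \oo --> limn (series (fun i => y i ^+ 2)).
    exact: l2_cvg_sqr.
  exact: filter_ex (cvgr_gt _ cvy _ ylt).
pose t := l2_dominated (tailP N); exists N, t; split.
- pose s := l2_dominated (headP N).
  have sN : series (fun i => y i ^+ 2) N <= `|s| ^+ 2.
    apply: le_trans (l2_sum_le s N).
    rewrite seriesEnat/= le_eqVlt; apply/orP; left; apply/eqP.
    by apply: eq_big_nat => i /andP[_ iN] /=; rewrite iN.
  (* Head and tail have disjoint supports, so the tail carries exactly the norm
     that the first [N] coordinates leave over. *)
  have : `|s| ^+ 2 + `|t| ^+ 2 <= `|y| ^+ 2.
    apply: l2_norm_sqrD_le => i /=; case: ifP => _; first by rewrite expr0n addr0.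
    by rewrite expr0n add0r real_normK ?num_real.
  move=> st; rewrite -(@ler_pXn2r _ 2)// ?nnegrE// ?(ltW e0)//.
  lra.
- by move=> i /=; case: ifP.
- by move=> i /= Ni; rewrite ltnNge Ni.
Qed.

Lemma l2_inner_single (R : realType) (i : nat) (z h : l2 R) :
  (forall j, j != i -> h j = 0) -> inner z h = z i * h i.
Proof.
move=> h0; apply: cvg_lim => //; apply: cvg_near_cst.
exists i.+1 => //= n /= ni; rewrite seriesEnat/= big_mkord.
rewrite (bigD1 (Ordinal ni))//= big1 ?addr0// => j ji.
by rewrite (h0 j) ?mulr0//.
Qed.

Lemma square_summable_single (R : realType) (i : nat) (t : R) :
  (fun j => if j == i then t else 0) \in @square_summable R.
Proof.
apply/asboolP/cvg_ex; exists (t ^+ 2); apply: cvg_near_cst.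
exists i.+1 => //= n /= ni; rewrite seriesEnat/= big_mkord.
rewrite (bigD1 (Ordinal ni))//= eqxx big1 ?addr0// => j ji.
by rewrite -val_eqE/= in ji; rewrite (negPf ji) expr0n.
Qed.

Definition l2_single (R : realType) (i : nat) (s : R) : l2 R :=
  L2 _ (square_summable_single i s).

Lemma l2_singleE (R : realType) (i : nat) (s : R) : l2_single i s i = s.
Proof. by rewrite /= eqxx. Qed.

Lemma l2_single0 (R : realType) (i j : nat) (s : R) :
  j != i -> l2_single i s j = 0.
Proof. by move=> /negPf /= ->. Qed.

Lemma norm_l2_single (R : realType) (i : nat) (s : R) : `|l2_single i s| = `|s|.
Proof.
apply/eqP; rewrite -(@eqrXn2 _ 2)// -inner_norm (@l2_inner_single _ i).
  by rewrite l2_singleE -expr2 real_normK ?num_real.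
by move=> j; exact: l2_single0.
Qed.

(** The coordinates of [x] may accumulate at [0], so a positive lower bound for
    the nonzero ones exists only over finitely many indices. *)
Lemma l2_gap (R : realType) (x : l2 R) (N : nat) :
  exists2 d : R, 0 < d & forall i, (i < N)%N -> x i != 0 -> d <= `|x i|.
Proof.
elim: N => [|N [d d0 dN]]; first by exists 1.
have [xN|xN] := eqVneq (x N) 0.
  exists d => // i; rewrite ltnS leq_eqVlt => /predU1P[->|]; last exact: dN.
  by rewrite xN eqxx.
exists (Num.min d `|x N|); first by rewrite lt_min d0 normr_gt0.
move=> i; rewrite ltnS leq_eqVlt ge_min => /predU1P[->|/dN di /di ->//].
by rewrite lexx orbT.
Qed.

(** * The one-dimensional estimates *)

Section scalar.
Context (R : realType) (a y z : R).

(** The quantity that must be [o(s)] from above for [z] to be in the coderivative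
    of [r |-> max r 0] at [a] in direction [y]. *)
Definition residual (s : R) : R :=
  z * s - y * (Num.max (a + s) 0 - Num.max a 0).

Definition coderivative_condition : Prop :=
  [/\ 0 < a -> z = y, a < 0 -> z = 0 & a = 0 -> 0 <= z <= y].

(** As long as [a + s] keeps the sign of [a], the positive part is affine between
    [a] and [a + s] and the residual vanishes; at [a = 0] it is [(z - y) s] for
    positive [s] and [z s] for negative [s]. *)
Lemma residual_le0 (s : R) : coderivative_condition ->
  (a != 0 -> `|s| < `|a|) -> residual s <= 0.
Proof.
move=> [zp zn z0] sa; rewrite /residual.
have [a0|a0|a0] := ltgtP a 0.
- have : `|s| < - a by rewrite -ltr0_norm// sa// lt_eqF.
  rewrite ltr_norml opprK => /andP[s1 s2]; rewrite zn//.
  by case: (lerP (a + s) 0) => ?; lra.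
- have : `|s| < a by rewrite -[ltRHS]gtr0_norm// sa// gt_eqF.
  rewrite ltr_norml => /andP[s1 s2]; rewrite zp//.
  by case: (lerP (a + s) 0) => ?; nra.
- have /andP[zge zle] := z0 a0; rewrite a0 add0r ?maxxx subr0.
  by case: (lerP s 0) => ?; nra.
Qed.

(** The crude bound for an increment [s] that may cross the kink at [0]; it holds
    for all [s], at the price of not being small relative to [s]. *)
Lemma residual_le (s : R) : coderivative_condition ->
  residual s <= `|y| * `|s|.
Proof.
move=> [zp zn z0]; rewrite /residual.
have := normr_max0B (a + s) a; rewrite (addrC a) addrK (addrC s).
case: (ltgtP a 0) => a0 ks.
- rewrite zn// mul0r sub0r -mulrN; apply: le_trans (ler_norm _) _.
  by rewrite normrM normrN ler_wpM2l.
- rewrite zp// -mulrBr; apply: le_trans (ler_norm _) _.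
  rewrite normrM ler_wpM2l//.
  have sge := ler_norm s; have : - s <= `|s| by rewrite -normrN ler_norm.
  by rewrite ler_norml; case: (lerP (a + s) 0) => ? ?; apply/andP; split; lra.
- have /andP[zge zle] := z0 a0; rewrite a0 add0r ?maxxx subr0.
  have : 0 <= `|y| * `|s| by rewrite mulr_ge0.
  by case: (lerP s 0) => ?; nra.
Qed.

Lemma residual_littleo : (forall e : R, 0 < e ->
    exists2 d, 0 < d & forall s, `|s| < d -> residual s <= e * `|s|) ->
  coderivative_condition.
Proof.
move=> small.
(* A step [s] small enough not to cross [0] from [a], tested in both directions;
   each case below divides the two inequalities by [s]. *)
have test e : 0 < e -> exists s, [/\ 0 < s, a != 0 -> s < `|a|,
    residual s <= e * s & residual (- s) <= e * s].
  move=> /small[d d0 Hd].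
  have [s [s0 sd sa]] : exists s, [/\ 0 < s, s < d & a != 0 -> s < `|a|].
    have [a0|a0] := eqVneq a 0; first by exists (d / 2); split => //; lra.
    have a1 : 0 < `|a| by rewrite normr_gt0.
    exists (Num.min d `|a| / 2).
    by case: (lerP d `|a|) => ?; split => // *; lra.
  exists s; split => //.
    by have := Hd s; rewrite gtr0_norm//; exact.
  by have := Hd (- s); rewrite normrN gtr0_norm//; exact.
split=> a0.
- have Hs e : 0 < e -> - e <= z - y <= e.
    move=> /test[s [s0]]; rewrite gt_eqF// gtr0_norm// => /(_ isT) sa.
    rewrite /residual (max_idPl (ltW a0)).
    rewrite (max_idPl (_ : 0 <= a + s)); last by lra.
    rewrite (max_idPl (_ : 0 <= a + - s)); last by lra.
    by move=> H1 H2; apply/andP; split; rewrite -(ler_pM2r s0); lra.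
  apply/eqP; rewrite eq_le; apply/andP; split; apply/ler_addgt0Pr => e /Hs; lra.
- have Hs e : 0 < e -> - e <= z <= e.
    move=> /test[s [s0]]; rewrite lt_eqF// ltr0_norm// => /(_ isT) sa.
    rewrite /residual (max_idPr (ltW a0)).
    rewrite (max_idPr (_ : a + s <= 0)); last by lra.
    rewrite (max_idPr (_ : a + - s <= 0)); last by lra.
    by move=> H1 H2; apply/andP; split; rewrite -(ler_pM2r s0); lra.
  apply/eqP; rewrite eq_le; apply/andP; split; apply/ler_addgt0Pr => e /Hs; lra.
- have Hs e : 0 < e -> - e <= z <= y + e.
    move=> /test[s [s0 _]]; rewrite /residual a0 !add0r maxxx !subr0.
    rewrite (max_idPl (ltW s0)) (max_idPr (_ : - s <= 0)); last by lra.
    by move=> H1 H2; apply/andP; split; rewrite -(ler_pM2r s0); lra.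
  by apply/andP; split; apply/ler_addgt0Pr => e /Hs; lra.
Qed.

End scalar.

(** * The coderivative of the projection *)

Theorem theorem4p1 (R : realType) (xbar : l2 R) :
  forall y : l2 R,
    regular_coderivative (metric_projection (positive_cone R)) xbar y =
    [set z : l2 R |
      [/\ forall i, pos_index xbar i -> z i = y i,
          forall i, neg_index xbar i -> z i = 0 &
          forall i, zero_index xbar i -> 0 <= z i <= y i]].
Proof.
move=> y; rewrite metric_projection_positive_cone; apply/seteqP; split => z.
  move=> /(regular_coderivative_nonexpansiveP _ _ _ (@l2_pos_nonexpansive R)) Hz.
  suff Hi i : coderivative_condition (xbar i) (y i) (z i).
    by split=> i ?; case: (Hi i) => *; auto.
  apply: residual_littleo => e /Hz/nbhs_normP[d /= d0 Hd]; exists d => // s sd.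
  have := Hd (l2_single i s); rewrite /ball_/= sub0r normrN norm_l2_single.
  move=> /(_ sd); rewrite !(@l2_inner_single _ i) => [|j ji|j ji].
  - by rewrite l2D l2N !l2_posE l2D l2_singleE.
  - by rewrite l2D l2N !l2_posE l2D l2_single0// addr0 subrr.
  - exact: l2_single0.
move=> [zp zn z0].
apply/(regular_coderivative_nonexpansiveP _ _ _ (@l2_pos_nonexpansive R)) => e e0.
have Hi i : coderivative_condition (xbar i) (y i) (z i) by split; auto.
(* Below [N] no coordinate of [h] reaches the kink; from [N] on [y] is small. *)
have [N [t [te t0 tN]]] := l2_tail_small y e0.
have [d d0 dN] := l2_gap xbar N.
apply/nbhs_normP; exists d => //= h; rewrite /ball_/= sub0r normrN => hd.
have abs_h i : `| `|h i| | <= `|h i| by rewrite normr_id.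
pose k := l2_dominated abs_h.
apply: (@le_trans _ _ (inner t k)).
  rewrite -linearNl; apply: ler_l2_innerD => i.
  rewrite l2N mulNr !l2D l2N !l2_posE l2D -/(residual _ _ _ _).
  have [iN|Ni] := ltnP i N; last by rewrite tN//; exact: residual_le.
  apply: (@le_trans _ _ 0); last by rewrite mulr_ge0 /=.
  apply: residual_le0 => // xi.
  exact: le_lt_trans (l2_coord_le _ _) (lt_le_trans hd (dN _ iN xi)).
apply: le_trans (ler_dot_normM (@l2_dot R) t k) _.
apply: ler_pM => //; rewrite ?sqrtr_ge0//.
by apply: (@ler_l2_norm R k h) => i /=; exact: abs_h.
Qed.
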